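(* Let $\Omega$ be a set and let $Q$ index a join-sub-semilattice $\{\mathcal{P}_x : x\in Q\}$ of $(Part(\Omega),\leq)$. Let $\Psi=\bigcup_{x\in Q}\Psi_x$, where $\Psi_x$ is the set of pairs $(\mathcal{D},x)$ with $\mathcal{D}\in\Phi(\Omega)$ and $x$ a support of $\mathcal{D}$, equipped with labeling $d(\mathcal{D},x):=x$, combination $(\mathcal{D}_1,x)\cdot(\mathcal{D}_2,y):=(\mathcal{D}_1\cdot\mathcal{D}_2,x\vee y)$ and transport $t_y(\mathcal{D},x):=(\epsilon_y(\mathcal{D}),y)$. Then $\Psi$ is a labeled information algebra, i.e. for all $x,y,z\in Q$ and all elements $(\mathcal{D},x),(\mathcal{D}_1,x),(\mathcal{D}_2,y)$ (and, in item 4, $(\mathcal{D},y)$ where it appears) of $\Psi$: 1. (Semigroup) $(\Psi,\cdot)$ is a commutative semigroup. 2. (Quasi-separoid) $(Q,\leq)$ is a join semilattice and the relation $\bot$ on $Q$ is a quasi-separoid. 3. (Labeling) $d((\mathcal{D}_1,x)\cdot(\mathcal{D}_2,y))=x\vee y$ and $d(t_y(\mathcal{D},x))=y$. 4. (Unit and null) $(1,x)\cdot(1,y)=(1,x\vee y)$; $(\mathcal{D},x)\cdot(1,x)=(\mathcal{D},x)$; $(\mathcal{D},x)\cdot(0,x)=(0,x)$; $t_y(\mathcal{D},x)=(0,y)$ if and only if $(\mathcal{D},x)=(0,x)$; and $(\mathcal{D},y)\cdot(1,x)=t_{x\vee y}(\mathcal{D},y)$. 5. (Transport) $x\bot y\vert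 z$ implies $t_y(\mathcal{D},x)=t_y(t_z(\mathcal{D},x))$. 6. (Combination) $x\bot y\vert z$ implies $t_z((\mathcal{D}_1,x)\cdot(\mathcal{D}_2,y))=t_z(\mathcal{D}_1,x)\cdot t_z(\mathcal{D}_2,y)$. 7. (Identity) $t_x(\mathcal{D},x)=(\mathcal{D},x)$. 8. (Idempotency) If $y\leq x$, then $t_y(\mathcal{D},x)\cdot(\mathcal{D},x)=(\mathcal{D},x)$.
   Context: Gambles. A gamble on a set $\Omega$ is a bounded function $f:\Omega\to\mathbb{R}$; $\mathcal{L}=\mathcal{L}(\Omega)$ is the set of all gambles and $\mathcal{L}^+:=\{f\in\mathcal{L}: f\geq 0, f\neq 0\}$. A set $\mathcal{D}\subseteq\mathcal{L}$ is coherent if (D1) $\mathcal{L}^+\subseteq\mathcal{D}$; (D2) the zero gamble is not in $\mathcal{D}$; (D3) $f,g\in\mathcal{D}$ implies $f+g\in\mathcal{D}$; (D4) $f\in\mathcal{D},\lambda>0$ implies $\lambda f\in\mathcal{D}$. $C(\Omega)$ is the family of coherent sets and $\Phi(\Omega):=C(\Omega)\cup\{\mathcal{L}(\Omega)\}$. For $\mathcal{D}'\subseteq\mathcal{L}$, $\mathcal{C}(\mathcal{D}'):=\bigcap\{\mathcal{D}\in\Phi(\Omega):\mathcal{D}'\subseteq\mathcal{D}\}$. Partitions and questions. $Part(\Omega)$ is the set of partitions of $\Omega$, ordered by: $\mathcal{P}\leq\mathcal{P}'$ iff every block of $\mathcal{P}'$ is contained in a block of $\mathcal{P}$ (finer is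 larger). The join $\mathcal{P}\vee\mathcal{P}'$ consists of the non-empty intersections of blocks of $\mathcal{P}$ with blocks of $\mathcal{P}'$. A family of partitions is indexed bijectively by $Q$ as $\{\mathcal{P}_x:x\in Q\}$; $x\leq y$ iff $\mathcal{P}_x\leq\mathcal{P}_y$, and $x\vee y$ is the index with $\mathcal{P}_{x\vee y}=\mathcal{P}_x\vee\mathcal{P}_y$. The relation $x\bot y\vert z$ means: for all blocks $B_1\in\mathcal{P}_x$, $B_2\in\mathcal{P}_y$, $B\in\mathcal{P}_z$ with $B_1\cap B\neq\emptyset$ and $B_2\cap B\neq\emptyset$, one has $B_1\cap B_2\cap B\neq\emptyset$. A three-place relation $\bot$ on a join semilattice $Q$ is a quasi-separoid if for all $x,y,z,w\in Q$: $x\bot y\vert y$; $x\bot y\vert z$ implies $y\bot x\vert z$; $x\bot y\vert z$ and $w\leq y$ imply $x\bot w\vert z$; $x\bot y\vert z$ implies $x\bot(y\vee z)\vert z$. $\mathcal{L}_x$ is the set of gambles that are constant on every block of $\mathcal{P}_x$. Operations on $\Phi(\Omega)$. Combination $\mathcal{D}_1\cdot\mathcal{D}_2:=\mathcal{C}(\mathcal{D}_1\cup\mathcal{D}_2)$; extraction $\epsilon_x(\mathcal{D}):=\mathcal{C}(\mathcal{D}\cap\mathcal{L}_x)$; $0:=\mathcal{L}(\Omega)$ and $1:=\mathcal{L}^+(\Omega)$. The element $x\in Q$ is a support of $\mathcal{D}\in\Phi(\Omega)$ if $\epsilon_x(\mathcal{D})=\mathcal{D}$. *)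

(* Defs.v *)
From HB Require Import structures.
From mathcomp Require Import all_boot all_order all_algebra.
From mathcomp Require Import all_classical all_reals all_analysis.

Set Implicit Arguments.
Unset Strict Implicit.
Unset Printing Implicit Defensive.

Import Order.TTheory GRing.Theory Num.Theory numFieldNormedType.Exports.

Local Open Scope classical_set_scope.
Local Open Scope ring_scope.

Section Gambles.
Variables (Omega : Type) (R : realType).
Implicit Types (D : set (Omega -> R)).

Definition gambles : set (Omega -> R) := [set f | bounded_fun f].

Definition pos_gambles : set (Omega -> R) :=
  [set f | [/\ gambles f, forall w, 0 <= f w & f <> cst 0]].

Definition coherent D : Prop :=
  D `<=` gambles /\
  [/\ pos_gambles `<=` D,
      ~ D (cst 0),
      forall f g, D f -> D g -> D (f \+ g) &
      forall f (a : R), D f -> 0 < a -> D (fun w => a * f w)].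

Definition Phi : set (set (Omega -> R)) := coherent `|` [set gambles].

(* [smallest Phi D] is the intersection of all members of [Phi] containing
   [D]. It is only ever taken at sets of gambles, for which this family is
   inhabited by [gambles]. *)
Definition closure_op D : set (Omega -> R) := smallest Phi D.

Definition comb D1 D2 : set (Omega -> R) := closure_op (D1 `|` D2).

End Gambles.

Section Partitions.
Variable Omega : Type.
Implicit Types (X Y Z : set (set Omega)).

(* A partition is given by its set of blocks. [partition] requires the blocks
   to be non-empty, pairwise disjoint, and to cover [setT]. *)
Definition is_partition X : Prop := classical_sets.partition X id [set: Omega].

Definition partition_le X Y : Prop :=
  forall B', Y B' -> exists2 B, X B & B' `<=` B.

Definition partition_join X Y : set (set Omega) :=
  [set C | C !=set0 /\ exists B B', [/\ X B, Y B' & C = B `&` B']].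

Definition partition_cond_indep X Y Z : Prop :=
  forall B1 B2 B, X B1 -> Y B2 -> Z B ->
    B1 `&` B !=set0 -> B2 `&` B !=set0 -> B1 `&` B2 `&` B !=set0.

End Partitions.

Section Semilattices.
Variables (Q : Type) (le : Q -> Q -> Prop) (vee : Q -> Q -> Q).

Definition join_semilattice : Prop :=
  [/\ forall x, le x x,
      forall x y, le x y -> le y x -> x = y,
      forall x y z, le x y -> le y z -> le x z &
      forall x y, [/\ le x (vee x y), le y (vee x y) &
        forall z, le x z -> le y z -> le (vee x y) z]].

Definition quasi_separoid (bot : Q -> Q -> Q -> Prop) : Prop :=
  [/\ forall x y, bot x y y,
      forall x y z, bot x y z -> bot y x z,
      forall x y z w, bot x y z -> le w y -> bot x w z &
      forall x y z, bot x y z -> bot x (vee y z) z].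

End Semilattices.

(* [P : Q -> set (set Omega)] is the family of partitions indexed by [Q]. *)
Section Questions.
Variables (Omega Q : Type) (P : Q -> set (set Omega)).

Definition qle (x y : Q) : Prop := partition_le (P x) (P y).

Definition qindep (x y z : Q) : Prop :=
  partition_cond_indep (P x) (P y) (P z).

Variable R : realType.
Implicit Types (D : set (Omega -> R)) (x y : Q).

Definition gambles_at x : set (Omega -> R) :=
  [set f | gambles f /\
    forall B, P x B -> forall w w', B w -> B w' -> f w = f w'].

Definition extract x D : set (Omega -> R) :=
  closure_op (D `&` gambles_at x).

Definition is_support x D : Prop := extract x D = D.

Definition Psi_at x : set (set (Omega -> R) * Q) :=
  [set (D, x) | D in [set D | Phi D /\ is_support x D]].

Definition Psi : set (set (Omega -> R) * Q) := \bigcup_x Psi_at x.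

Definition label (p : set (Omega -> R) * Q) : Q := p.2.

Definition lcomb (vee : Q -> Q -> Q) (p q : set (Omega -> R) * Q) :
    set (Omega -> R) * Q :=
  (comb p.1 q.1, vee p.2 q.2).

Definition transport y (p : set (Omega -> R) * Q) : set (Omega -> R) * Q :=
  (extract y p.1, y).

End Questions.

Arguments gambles : clear implicits.
Arguments pos_gambles : clear implicits.
Arguments Psi {Omega Q} P R.

(* Main.v *)
Require Import Defs.
From HB Require Import structures.
From mathcomp Require Import all_boot all_order all_algebra.
From mathcomp Require Import all_classical all_reals all_analysis.

Set Implicit Arguments.
Unset Strict Implicit.
Unset Printing Implicit Defensive.

Local Open Scope classical_set_scope.
Local Open Scope ring_scope.

Import Order.TTheory GRing.Theory Num.Theory.

(** The closure of a set of gambles [A] which is closed under addition and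
    positive scaling consists of the gambles dominating some element of [A],
    together with the positive gambles.  Hence, if [D] has support [x] and
    [f] in [D] is constant on the blocks of [P y], then [f >= g] for some [g]
    in [D] constant on the blocks of [P x] (or [f] is positive).  When [x] and
    [y] are independent given [z], every value of [g] on a block of [P z] is at
    most every value of [f] on that block, so the blockwise supremum [h] of [g]
    over [P z] satisfies [g <= h <= f]: it is a gamble of [D] at [z] that
    interpolates between [g] and [f].  This gives the transport axiom, and the
    same argument applied to a sum [g1 + g2 <= f] gives the combination axiom.
    Everything else follows from the universal property of the closure. *)

(** * Partitions through their points *)

Section PartitionTheory.
Variable Omega : Type.
Implicit Types (X Y Z W : set (set Omega)) (w : Omega).

(** Pointwise view of a partition: when [X] is a partition this is the associated equivalence
    relation, which lets constancy on blocks be used without naming blocks. *)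
Definition same_block X w w' : Prop := exists B, [/\ X B, B w & B w'].

Lemma block_eq X B B' w :
  is_partition X -> X B -> X B' -> B w -> B' w -> B = B'.
Proof. by case=> _ tX _ XB XB' Bw B'w; apply: tX => //; exists w. Qed.

Lemma block_ex X w : is_partition X -> exists2 B, X B & B w.
Proof. by case=> cX _ _; have : [set: Omega] w by []; rewrite -cX. Qed.

Lemma block_neq0 X B : is_partition X -> X B -> B !=set0.
Proof. by case=> _ _; apply. Qed.

Lemma same_block_refl X w : is_partition X -> same_block X w w.
Proof. by move=> /block_ex - /(_ w) [B XB Bw]; exists B. Qed.

Lemma same_block_sym X w w' : same_block X w w' -> same_block X w' w.
Proof. by move=> [B [XB Bw Bw']]; exists B. Qed.

Lemma same_block_trans X w1 w2 w3 : is_partition X ->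
  same_block X w1 w2 -> same_block X w2 w3 -> same_block X w1 w3.
Proof.
move=> pX [B [XB B1 B2]] [B' [XB' B'2 B'3]]; exists B; split => //.
by rewrite (block_eq pX XB XB' B2 B'2).
Qed.

Lemma partition_le_same_block X Y w w' :
  partition_le X Y -> same_block Y w w' -> same_block X w w'.
Proof.
move=> XY [B [YB Bw Bw']]; have [B' XB' BB'] := XY _ YB.
by exists B'; split => //; apply: BB'.
Qed.

(** The [X]-block of [w] and the [Y]-block of [w'] both meet the [Z]-block shared by the two points;
    [u] is any point of the triple intersection. This is the form in which independence is applied
    to gambles. *)
Lemma cond_indep_same_block X Y Z w w' :
  is_partition X -> is_partition Y -> partition_cond_indep X Y Z ->
  same_block Z w w' ->
  exists u, [/\ same_block X w u, same_block Y w' u & same_block Z w u].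
Proof.
move=> pX pY XYZ [B [ZB Bw Bw']].
have [B1 XB1 B1w] := block_ex w pX; have [B2 YB2 B2w'] := block_ex w' pY.
have [u [[B1u B2u] Bu]] : B1 `&` B2 `&` B !=set0.
  by apply: XYZ => //; [exists w | exists w'].
by exists u; split; [exists B1 | exists B2 | exists B].
Qed.

(** * The refinement order and its joins *)

Lemma partition_le_refl X : partition_le X X.
Proof. by move=> B XB; exists B. Qed.

Lemma partition_le_trans X Y Z :
  partition_le X Y -> partition_le Y Z -> partition_le X Z.
Proof.
move=> XY YZ B ZB; have [B' YB' BB'] := YZ _ ZB.
have [B'' XB'' B'B''] := XY _ YB'.
by exists B'' => //; apply: subset_trans B'B''.
Qed.

(** A block [B] of [Y] sits in a block [B'] of [X], itself in a block [B''] of [Y]. As [B] and [B'']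
    share a point they coincide, which squeezes [B'] to [B]. *)
Lemma partition_le_anti_sub X Y : is_partition Y ->
  partition_le X Y -> partition_le Y X -> Y `<=` X.
Proof.
move=> pY XY YX B YB; have [B' XB' BB'] := XY _ YB.
have [B'' YB'' B'B''] := YX _ XB'.
have [w Bw] := block_neq0 pY YB.
have BE : B = B'' by apply: (block_eq pY YB YB'' Bw); apply/B'B''/BB'.
by suff -> : B = B' by []; apply/seteqP; split => //; rewrite BE.
Qed.

Lemma partition_le_anti X Y : is_partition X -> is_partition Y ->
  partition_le X Y -> partition_le Y X -> X = Y.
Proof.
by move=> pX pY XY YX; apply/seteqP; split; apply: partition_le_anti_sub.
Qed.

Lemma partition_le_joinl X Y : partition_le X (partition_join X Y).
Proof. by move=> _ [_ [B [B' [XB _ ->]]]]; exists B => // w []. Qed.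

Lemma partition_le_joinr X Y : partition_le Y (partition_join X Y).
Proof. by move=> _ [_ [B [B' [_ YB' ->]]]]; exists B' => // w []. Qed.

Lemma partition_join_le X Y Z : is_partition Z ->
  partition_le X Z -> partition_le Y Z -> partition_le (partition_join X Y) Z.
Proof.
move=> pZ XZ YZ B ZB; have [B1 XB1 BB1] := XZ _ ZB; have [B2 YB2 BB2] := YZ _ ZB.
have BB12 : B `<=` B1 `&` B2 by move=> w Bw; split; [apply: BB1 | apply: BB2].
exists (B1 `&` B2) => //; split; last by exists B1, B2.
by have [w /BB12] := block_neq0 pZ ZB; exists w.
Qed.

(** * Quasi-separoid laws for conditional independence *)

Lemma cond_indep_id X Y : is_partition Y -> partition_cond_indep X Y Y.
Proof.
move=> pY B1 B2 B XB1 YB2 YB [w [B1w Bw]] [w' [B2w' Bw']].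
have -> : B2 = B by apply: (block_eq pY YB2 YB B2w' Bw').
by exists w.
Qed.

Lemma cond_indep_sym X Y Z :
  partition_cond_indep X Y Z -> partition_cond_indep Y X Z.
Proof.
move=> XYZ B1 B2 B YB1 XB2 ZB B1B B2B.
by rewrite [B1 `&` B2]setIC; apply: XYZ.
Qed.

(** A point of [B2] and [B] selects a [Y]-block [C] meeting [B]; since [W] is coarser, [C] lies
    inside [B2], so a point of [B1], [C] and [B] serves. *)
Lemma cond_indep_le X Y Z W : is_partition Y -> is_partition W ->
  partition_cond_indep X Y Z -> partition_le W Y -> partition_cond_indep X W Z.
Proof.
move=> pY pW XYZ WY B1 B2 B XB1 WB2 ZB B1B [w [B2w Bw]].
have [C YC Cw] := block_ex w pY; have [C' WC' CC'] := WY _ YC.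
have [u [[B1u Cu] Bu]] : B1 `&` C `&` B !=set0 by apply: XYZ => //; exists w.
exists u; split=> //; split=> //.
by rewrite (block_eq pW WB2 WC' B2w (CC' _ Cw)); apply: CC'.
Qed.

(** A block of the join has the form [B2] meet [B'] with [B'] in [Z]; it can meet [B] only if [B']
    is [B], which reduces the claim to [B2]. *)
Lemma cond_indep_join X Y Z : is_partition Z -> partition_cond_indep X Y Z ->
  partition_cond_indep X (partition_join Y Z) Z.
Proof.
move=> pZ XYZ B1 _ B XB1 [_ [B2 [B' [YB2 ZB' ->]]]] ZB B1B [w [[B2w B'w] Bw]].
rewrite (block_eq pZ ZB' ZB B'w Bw).
have [u [[B1u B2u] Bu]] : B1 `&` B2 `&` B !=set0 by apply: XYZ => //; exists w.
by exists u.
Qed.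

End PartitionTheory.

(** * Gambles, coherence and the family [Phi] *)

Section Gambles.
Variables (R : realType) (Omega : Type).
Implicit Types (f g h : Omega -> R) (A D E : set (Omega -> R)).

Local Notation G := (gambles Omega R).
Local Notation pos := (pos_gambles Omega R).

Lemma gamblesP f : G f <-> exists M, forall w, `|f w| <= M.
Proof.
split=> [[M [_ HM]]|[M HM]].
  (* [bounded_fun] only provides bounds strictly above [M], hence the shift by one. *)
  by exists (M + 1) => w; apply: (HM (M + 1)) => //; rewrite ltrDl.
exists M; split; first exact: num_real.
by move=> y /ltW My w _; apply: le_trans (HM w) My.
Qed.

Lemma gambles_cst (a : R) : G (cst a).
Proof. by apply/gamblesP; exists `|a|. Qed.

Lemma gamblesD f g : G f -> G g -> G (f \+ g).
Proof.
move=> /gamblesP[M fM] /gamblesP[N gN]; apply/gamblesP; exists (M + N) => w.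
by apply: le_trans (ler_normD _ _) _; apply: lerD.
Qed.

Lemma gamblesZ f (a : R) : G f -> G (fun w => a * f w).
Proof.
move=> /gamblesP[M fM]; apply/gamblesP; exists (`|a| * M) => w.
by rewrite normrM; apply: ler_wpM2l.
Qed.

Lemma gamblesB f g : G f -> G g -> G (f \- g).
Proof.
move=> Gf Gg; have -> : f \- g = f \+ (fun w => -1 * g w).
  by apply/funext => w /=; rewrite mulN1r.
by apply: gamblesD => //; apply: gamblesZ.
Qed.

Lemma pos_gamblesP f : pos f <->
  [/\ G f, forall w, 0 <= f w & exists w, 0 < f w].
Proof.
split=> -[Gf f0 fn0]; split=> //; last first.
  by case: fn0 => w fw f0'; move: fw; rewrite f0' /= ltxx.
apply: contrapT => nf; apply: fn0; apply/funext => w /=.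
apply/eqP; rewrite eq_le f0 andbT leNgt; apply/negP => fw.
by apply: nf; exists w.
Qed.

Lemma pos_gambles_coherent : coherent pos.
Proof.
split; first by move=> f [].
split => //.
- by case=> _ _; apply.
- move=> f g /pos_gamblesP[Gf f0 [w fw]] /pos_gamblesP[Gg g0 _].
  apply/pos_gamblesP; split; [exact: gamblesD| |].
    by move=> w' /=; apply: addr_ge0.
  by exists w => /=; apply: ltr_wpDr.
- move=> f a /pos_gamblesP[Gf f0 [w fw]] a0; apply/pos_gamblesP; split.
  + exact: gamblesZ.
  + by move=> w'; apply: mulr_ge0 => //; apply: ltW.
  + by exists w; apply: mulr_gt0.
Qed.

Lemma Phi_pos_gambles : Phi pos.
Proof. by left; apply: pos_gambles_coherent. Qed.

Lemma Phi_gambles : Phi G.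
Proof. by right. Qed.

Lemma Phi_sub_gambles D : Phi D -> D `<=` G.
Proof. by case=> [[]|->]. Qed.

Lemma pos_sub_Phi D : Phi D -> pos `<=` D.
Proof. by case=> [[_ []]//|->] f []. Qed.

Lemma PhiD D f g : Phi D -> D f -> D g -> D (f \+ g).
Proof. by case=> [[_ [_ _ + _]]|->]; [apply | apply: gamblesD]. Qed.

Lemma PhiZ D f (a : R) : Phi D -> D f -> 0 < a -> D (fun w => a * f w).
Proof. by case=> [[_ [_ _ _ +]]|-> + _]; [apply | apply: gamblesZ]. Qed.

Lemma Phi_null D : Phi D -> D (cst 0) -> D = G.
Proof. by case=> [[_ [_ +]]|]. Qed.

(** Write [g] as [f] plus [g - f]: unless [f = g], the difference is a positive gamble and so
    belongs to [D]. *)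
Lemma Phi_upclosed D f g :
  Phi D -> D f -> G g -> (forall w, f w <= g w) -> D g.
Proof.
move=> PD Df Gg fg; have [<-//|fgn] := pselect (f = g).
have -> : g = f \+ (g \- f) by apply/funext => w /=; rewrite subrKC.
apply: PhiD => //; apply: pos_sub_Phi => //; split.
- by apply: gamblesB => //; apply: Phi_sub_gambles Df.
- by move=> w /=; rewrite subr_ge0.
- move=> gf0; apply: fgn; apply/funext => w; apply/esym/eqP.
  by rewrite -subr_eq0; apply/eqP; exact: (congr1 (@^~ w) gf0).
Qed.

(** * Closure and combination *)

Lemma sub_closure_op A : A `<=` closure_op A.
Proof. exact: sub_gen_smallest. Qed.

Lemma closure_op_min A D : Phi D -> A `<=` D -> closure_op A `<=` D.
Proof. exact: smallest_sub. Qed.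

(** If some coherent set contains [A], the intersection inherits the closure properties and avoids
    zero thanks to that set. Otherwise only the set of all gambles takes part in the
    intersection. *)
Lemma Phi_closure_op A : A `<=` G -> Phi (closure_op A).
Proof.
move=> AG; have [[D [cD AD]]|noD] := pselect (exists D, coherent D /\ A `<=` D).
  have CD : closure_op A `<=` D by apply: closure_op_min => //; left.
  left; split; first by move=> f /CD; case: cD => + _; apply.
  split=> [f fpos E [PE _]|/CD|f g Cf Cg E EA|f a Cf a0 E EA].
  - exact: pos_sub_Phi fpos.
  - by case: cD => _ [].
  - by case: (EA) => PE _; apply: PhiD => //; [apply: Cf | apply: Cg].
  - by case: (EA) => PE _; apply: PhiZ => //; apply: Cf.
right; apply/seteqP; split; first exact: closure_op_min Phi_gambles AG.
move=> f Gf E [[cE|->//] AE]; exfalso; apply: noD; by exists E.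
Qed.

Lemma Phi_comb D1 D2 : Phi D1 -> Phi D2 -> Phi (comb D1 D2).
Proof.
move=> P1 P2; apply: Phi_closure_op => f.
by case; apply: Phi_sub_gambles.
Qed.

Lemma sub_combl D1 D2 : D1 `<=` comb D1 D2.
Proof. by move=> f D1f; apply: sub_closure_op; left. Qed.

Lemma sub_combr D1 D2 : D2 `<=` comb D1 D2.
Proof. by move=> f D2f; apply: sub_closure_op; right. Qed.

Lemma comb_min D1 D2 E :
  Phi E -> D1 `<=` E -> D2 `<=` E -> comb D1 D2 `<=` E.
Proof.
move=> PE D1E D2E; apply: closure_op_min => // f.
by case; [apply: D1E | apply: D2E].
Qed.

Lemma combC D1 D2 : comb D1 D2 = comb D2 D1.
Proof. by rewrite /comb setUC. Qed.

Lemma combA D1 D2 D3 : Phi D1 -> Phi D2 -> Phi D3 ->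
  comb D1 (comb D2 D3) = comb (comb D1 D2) D3.
Proof.
move=> P1 P2 P3; have P12 := Phi_comb P1 P2; have P23 := Phi_comb P2 P3.
have P123 := Phi_comb P12 P3; have P123' := Phi_comb P1 P23.
apply/seteqP; split; repeat (apply: comb_min => //).
- by apply: subset_trans (@sub_combl _ _); apply: sub_combl.
- by apply: subset_trans (@sub_combl _ _); apply: sub_combr.
- exact: sub_combr.
- exact: sub_combl.
- by apply: subset_trans (@sub_combr _ _); apply: sub_combl.
- by apply: subset_trans (@sub_combr _ _); apply: sub_combr.
Qed.

Lemma comb_subr D1 D2 : Phi D2 -> D1 `<=` D2 -> comb D1 D2 = D2.
Proof.
move=> P2 D12; apply/seteqP; split; last exact: sub_combr.
exact: comb_min.
Qed.

(** Explicit candidate for the combination. [D1] and [D2] are listed separately because coherent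
    sets lack zero, so the sums alone need not include them. *)
Definition sumset D1 D2 : set (Omega -> R) :=
  D1 `|` D2 `|` [set f \+ g | f in D1 & g in D2].

Lemma sumset_coherent D1 D2 : Phi D1 -> Phi D2 ->
  ~ sumset D1 D2 (cst 0) -> coherent (sumset D1 D2).
Proof.
move=> P1 P2 S0; split.
  move=> h [[D1h|D2h]|[f D1f [g D2g <-]]].
  - exact: Phi_sub_gambles D1h.
  - exact: Phi_sub_gambles D2h.
  - by apply: gamblesD; [apply: Phi_sub_gambles D1f | apply: Phi_sub_gambles D2g].
(* Rearrangements used below to collect the [D1]-parts and the [D2]-parts of a sum in each of the
   nine cases. *)
have DD f f' g g' : f \+ g \+ (f' \+ g') = (f \+ f') \+ (g \+ g').
  by apply/funext => w /=; rewrite addrACA.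
have DC f g : f \+ g = g \+ f by apply/funext => w /=; rewrite addrC.
have DA f g h : f \+ g \+ h = f \+ (g \+ h).
  by apply/funext => w /=; rewrite addrA.
split=> //.
- by move=> f fpos; left; left; apply: pos_sub_Phi fpos.
- move=> h h' [[D1f|D2f]|[f D1f [g D2g <-]]] [[D1f'|D2f']|[f' D1f' [g' D2g' <-]]].
  + by left; left; apply: PhiD.
  + by right; exists h => //; exists h'.
  + by rewrite -DA; right; exists (h \+ f'); [exact: PhiD | exists g'].
  + by rewrite DC; right; exists h' => //; exists h.
  + by left; right; apply: PhiD.
  + by rewrite DC DA; right; exists f' => //; exists (g' \+ h); [exact: PhiD|].
  + by rewrite DC -DA; right; exists (h' \+ f); [exact: PhiD | exists g].
  + by rewrite DA; right; exists f => //; exists (g \+ h'); [exact: PhiD|].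
  + rewrite DD; right; exists (f \+ f'); first exact: PhiD.
    by exists (g \+ g'); first exact: PhiD.
- move=> h a [[D1f|D2f]|[f D1f [g D2g <-]]] a0.
  + by left; left; apply: PhiZ.
  + by left; right; apply: PhiZ.
  + right; exists (fun w => a * f w); first exact: PhiZ.
    exists (fun w => a * g w); first exact: PhiZ.
    by apply/funext => w /=; rewrite mulrDr.
Qed.

(** When zero is not in the sumset, the sumset is coherent and contains both sets, hence their
    combination. The second alternative is the inconsistent case, where the combination is all
    gambles. *)
Lemma comb_sumset D1 D2 f : Phi D1 -> Phi D2 -> comb D1 D2 f ->
  sumset D1 D2 f \/ sumset D1 D2 (cst 0).
Proof.
move=> P1 P2 Cf; have [|S0] := pselect (sumset D1 D2 (cst 0)); first by right.
left; apply: comb_min Cf; first by left; apply: sumset_coherent.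
- by move=> g; left; left.
- by move=> g; left; right.
Qed.

End Gambles.

(** * Measurable gambles, extraction and supports *)

Section ExtractionOperators.
Variables (R : realType) (Omega Q : Type) (P : Q -> set (set Omega)).
Hypothesis P_partition : forall x, is_partition (P x).
Implicit Types (f g : Omega -> R) (A D E : set (Omega -> R)) (x y z : Q).

Local Notation G := (gambles Omega R).
Local Notation pos := (pos_gambles Omega R).
Local Notation Lat x := (gambles_at P (R := R) x).

Lemma gambles_atP x f :
  Lat x f <-> G f /\ forall w w', same_block (P x) w w' -> f w = f w'.
Proof.
split=> -[Gf fE]; split=> //.
  by move=> w w' [B [PB Bw Bw']]; apply: fE Bw Bw'.
by move=> B PB w w' Bw Bw'; apply: fE; exists B.
Qed.

Lemma gambles_at_cst x (a : R) : Lat x (cst a).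
Proof. by split; first exact: gambles_cst. Qed.

Lemma gambles_at_le x y : qle P x y -> Lat x `<=` Lat y.
Proof.
move=> xy f /gambles_atP[Gf fE]; apply/gambles_atP; split=> // w w' ww'.
by apply: fE; apply: partition_le_same_block ww'.
Qed.

Lemma gambles_atD x f g : Lat x f -> Lat x g -> Lat x (f \+ g).
Proof.
move=> [Gf fE] [Gg gE]; split; first exact: gamblesD.
by move=> B PB w w' Bw Bw' /=; rewrite (fE B PB w w') // (gE B PB w w').
Qed.

Lemma gambles_atZ x f (a : R) : Lat x f -> Lat x (fun w => a * f w).
Proof.
move=> [Gf fE]; split; first exact: gamblesZ.
by move=> B PB w w' Bw Bw' /=; rewrite (fE B PB w w').
Qed.

Lemma Phi_extract x D : Phi D -> Phi (extract P x D).
Proof. by move=> PD; apply: Phi_closure_op => f [_ []]. Qed.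

Lemma sub_extract x D : D `&` Lat x `<=` extract P x D.
Proof. exact: sub_closure_op. Qed.

Lemma extract_min x D E : Phi E -> D `&` Lat x `<=` E -> extract P x D `<=` E.
Proof. exact: closure_op_min. Qed.

Lemma extract_sub x D : Phi D -> extract P x D `<=` D.
Proof. by move=> PD; apply: extract_min => // f []. Qed.

Lemma extract_mono x D E : Phi E -> D `<=` E -> extract P x D `<=` extract P x E.
Proof.
move=> PE DE; apply: extract_min; first exact: Phi_extract.
by move=> f [/DE Ef Lf]; apply: sub_extract.
Qed.

Lemma extract_pos x : extract P x pos = pos.
Proof.
apply/seteqP; split; first by apply: extract_sub; apply: Phi_pos_gambles.
by apply: pos_sub_Phi; apply: Phi_extract; apply: Phi_pos_gambles.
Qed.

Lemma extract_gambles x : extract P x G = G.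
Proof.
apply: Phi_null; first by apply: Phi_extract; apply: Phi_gambles.
by apply: sub_extract; split; [exact: gambles_cst | exact: gambles_at_cst].
Qed.

Lemma extract_id x D : Phi D -> extract P x (extract P x D) = extract P x D.
Proof.
move=> PD; apply/seteqP; split; first by apply: extract_sub; apply: Phi_extract.
apply: extract_min; first by do 2!apply: Phi_extract.
by move=> f fx; apply: sub_extract; split; [exact: sub_extract | case: fx].
Qed.

Lemma extract_eq_gambles x D : Phi D -> extract P x D = G -> D = G.
Proof.
move=> PD eG; apply/seteqP; split; first exact: Phi_sub_gambles.
by rewrite -eG; apply: extract_sub.
Qed.

(** The gambles at [x] that generate [D] are also gambles at the finer [y]. *)
Lemma support_le x y D :
  Phi D -> qle P x y -> is_support P x D -> is_support P y D.
Proof.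
move=> PD xy sD; apply/seteqP; split; first exact: extract_sub.
rewrite -{1}sD; apply: extract_min; first exact: Phi_extract.
by move=> f [Df Lf]; apply: sub_extract; split => //; apply: gambles_at_le Lf.
Qed.

Lemma support_comb x D1 D2 : Phi D1 -> Phi D2 ->
  is_support P x D1 -> is_support P x D2 -> is_support P x (comb D1 D2).
Proof.
move=> P1 P2 s1 s2; have P12 := Phi_comb P1 P2.
apply/seteqP; split; first exact: extract_sub.
apply: comb_min; first exact: Phi_extract.
- by rewrite -{1}s1; apply: extract_mono => //; apply: sub_combl.
- by rewrite -{1}s2; apply: extract_mono => //; apply: sub_combr.
Qed.

(** * Domination by measurable gambles and blockwise suprema *)

Definition dominators x D : set (Omega -> R) :=
  [set f | exists2 g, (D `&` Lat x) g & forall w, g w <= f w].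

(** For coherent [D], the right-hand set cut down to gambles is coherent and contains the generators
    of the extraction, so minimality of the closure applies. *)
Lemma extract_dominates x D f : Phi D -> extract P x D f ->
  (pos `|` dominators x D) f.
Proof.
move=> PD eDf; have Gf : G f by apply: Phi_sub_gambles (Phi_extract x PD) _ eDf.
case: (PD) => [cD|DG]; last first.
  (* If [D] is all gambles, a constant lower bound of [f] is an admissible dominated gamble. *)
  right; have /gamblesP[M fM] := Gf; exists (cst (- M)).
    by rewrite DG; split; [exact: gambles_cst | exact: gambles_at_cst].
  by move=> w /=; have := fM w; rewrite ler_norml => /andP[].
(* The intersection with [G] is needed because a function dominating a gamble may be unbounded
   above. *)
suff coh : coherent (pos `|` (G `&` dominators x D)).
  have : (pos `|` (G `&` dominators x D)) f.
    apply: extract_min eDf; first by left.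
    by move=> g Dg; right; split; [case: Dg => _ [] | exists g].
  by move=> [|[]]; [left | right].
have [_ [_ posN0 posD posZ]] := pos_gambles_coherent R Omega.
split; first by move=> g [[]|[]].
split.
- by move=> g; left.
(* If zero dominated some [g] in [D], upward closure would put zero in [D]. *)
- move=> [//|[_ [g [Dg _] g0]]]; case: (cD) => _ [_ + _ _]; apply.
  exact: Phi_upclosed Dg (gambles_cst _ _) g0.
- move=> f1 f2 [p1|[G1 [g1 [D1 L1] gf1]]] [p2|[G2 [g2 [D2 L2] gf2]]].
  + by left; apply: posD.
  + case: p1 => G1 f1_ge0 _; right; split; first exact: gamblesD.
    by exists g2 => // w; apply: le_trans (gf2 w) _; rewrite /= lerDr.
  + case: p2 => G2 f2_ge0 _; right; split; first exact: gamblesD.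
    by exists g1 => // w; apply: le_trans (gf1 w) _; rewrite /= lerDl.
  + right; split; first exact: gamblesD.
    exists (g1 \+ g2); last by move=> w /=; apply: lerD.
    by split; [exact: PhiD | exact: gambles_atD].
- move=> f1 a [p1|[G1 [g1 [D1 L1] gf1]]] a0.
  + by left; apply: posZ.
  + right; split; first exact: gamblesZ.
    exists (fun w => a * g1 w); last by move=> w; rewrite ler_pM2l.
    by split; [exact: PhiZ | exact: gambles_atZ].
Qed.

(** For a gamble [g], this is the least majorant of [g] that is constant on the blocks of [P z]. *)
Definition block_sup z g w : R :=
  sup [set g w' | w' in [set w' | same_block (P z) w w']].

Lemma block_sup_le z g w (M : R) :
  (forall w', same_block (P z) w w' -> g w' <= M) -> block_sup z g w <= M.
Proof.
move=> gM; apply: ge_sup; last by move=> _ [w' ww' <-]; apply: gM.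
by exists (g w), w => //=; apply: same_block_refl.
Qed.

Lemma le_block_sup z g w w' : G g ->
  same_block (P z) w w' -> g w' <= block_sup z g w.
Proof.
move=> /gamblesP[M gM] ww'; apply: ub_le_sup; last by exists w'.
by exists M => _ [u _ <-]; apply: le_trans (gM u); apply: ler_norm.
Qed.

Lemma ge_block_sup z g w : G g -> g w <= block_sup z g w.
Proof. by move=> Gg; apply: le_block_sup => //; apply: same_block_refl. Qed.

Lemma block_sup_at z g : G g -> Lat z (block_sup z g).
Proof.
move=> Gg; apply/gambles_atP; split.
  have /gamblesP[M gM] := Gg; apply/gamblesP; exists M => w.
  have gM' u : - M <= g u <= M by rewrite -ler_norml.
  rewrite ler_norml; apply/andP; split.
    by apply: le_trans (ge_block_sup z w Gg); have /andP[] := gM' w.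
  by apply: block_sup_le => w' _; have /andP[] := gM' w'.
(* One inequality suffices: [same_block] is symmetric, so it also gives the reverse. *)
have mono w w' : same_block (P z) w w' -> block_sup z g w' <= block_sup z g w.
  move=> ww'; apply: block_sup_le => u w'u; apply: le_block_sup => //.
  exact: same_block_trans ww' w'u.
move=> w w' ww'; apply/le_anti; rewrite !mono //; exact: same_block_sym.
Qed.

Lemma block_sup_mem z D g : Phi D -> D g -> (D `&` Lat z) (block_sup z g).
Proof.
move=> PD Dg; have Gg := Phi_sub_gambles PD Dg; have Lh := block_sup_at z Gg.
split=> //; apply: Phi_upclosed Dg _ _ => //; first by case: Lh.
by move=> w; apply: ge_block_sup.
Qed.

(** * Transport and combination under conditional independence *)

Lemma extract_at_le x D f : Phi D -> is_support P x D -> D f ->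
  (pos `|` dominators x D) f.
Proof. by move=> PD sD Df; apply: extract_dominates => //; rewrite sD. Qed.

Lemma extract_extract_indep x y z D : Phi D -> is_support P x D ->
  qindep P x y z -> extract P y D = extract P y (extract P z D).
Proof.
move=> PD sD xyz; have PzD := Phi_extract z PD; apply/seteqP; split; last first.
  by apply: extract_mono => //; apply: extract_sub.
apply: extract_min; first exact: Phi_extract.
move=> f [Df Lf]; apply: sub_extract; split => //.
have [fpos|[g [Dg Lg] gf]] := extract_at_le PD sD Df.
  exact: pos_sub_Phi fpos.
have [hD hL] := block_sup_mem z PD Dg.
have hzD : extract P z D (block_sup z g) by apply: sub_extract.
apply: Phi_upclosed hzD _ _ => //; first by case: Lf.
move=> w; apply: block_sup_le => w' ww'.
(* The point [u] agrees with [w'] for [x] and with [w] for [y], so [g w' = g u <= f u = f w]. *)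
have [u [w'u wu _]] := cond_indep_same_block (P_partition x) (P_partition y) xyz
  (same_block_sym ww').
have /gambles_atP[_ gE] := Lg; have /gambles_atP[_ fE] := Lf.
by rewrite (gE _ _ w'u) (fE _ _ wu).
Qed.

(** For [w1], [w2] in the [z]-block of [w], independence gives [u] in that block matching [w1] for
    [x] and [w2] for [y]; then [g1 w1 + g2 w2 = g1 u + g2 u <= f u = f w]. The suprema are taken one
    at a time. *)
Lemma block_supD_le x y z f g1 g2 : qindep P x y z ->
  Lat x g1 -> Lat y g2 -> Lat z f -> (forall w, g1 w + g2 w <= f w) ->
  forall w, block_sup z g1 w + block_sup z g2 w <= f w.
Proof.
move=> xyz /gambles_atP[_ g1E] /gambles_atP[_ g2E] /gambles_atP[_ fE] gf w.
rewrite -lerBrDr; apply: block_sup_le => w1 ww1.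
rewrite lerBrDr addrC -lerBrDr; apply: block_sup_le => w2 ww2.
rewrite lerBrDr addrC.
have w12 := same_block_trans (P_partition z) (same_block_sym ww1) ww2.
have [u [w1u w2u w1u']] :=
  cond_indep_same_block (P_partition x) (P_partition y) xyz w12.
rewrite (g1E _ _ w1u) (g2E _ _ w2u).
by rewrite (fE _ _ (same_block_trans (P_partition z) ww1 w1u')).
Qed.

Lemma extract_comb_indep x y z D1 D2 : Phi D1 -> Phi D2 ->
  is_support P x D1 -> is_support P y D2 -> qindep P x y z ->
  extract P z (comb D1 D2) = comb (extract P z D1) (extract P z D2).
Proof.
move=> P1 P2 s1 s2 xyz.
have P12 := Phi_comb P1 P2; have Pz1 := Phi_extract z P1.
have Pz2 := Phi_extract z P2.
have PE := Phi_comb Pz1 Pz2; set E := comb (extract P z D1) _ in PE *.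
have D1E : D1 `&` Lat z `<=` E.
  by apply: subset_trans (@sub_combl _ _ _ _); apply: sub_extract.
have D2E : D2 `&` Lat z `<=` E.
  by apply: subset_trans (@sub_combr _ _ _ _); apply: sub_extract.
(* Core of the nontrivial inclusion: for a genuine sum, both summands are replaced by gambles they
   dominate, whose blockwise suprema lie in [E] and add up to at most [k]. *)
have sumE k : sumset D1 D2 k -> Lat z k -> E k.
  move=> [[D1k|D2k]|[f1 D1f1 [f2 D2f2 <-]]] Lk; [exact: D1E|exact: D2E|].
  have G1 := Phi_sub_gambles P1 D1f1; have G2 := Phi_sub_gambles P2 D2f2.
  (* If one summand is positive, the sum dominates the other summand and already lies in the set of
     that summand. *)
  have [[_ f1_ge0 _]|[g1 [Dg1 Lg1] gf1]] := extract_at_le P1 s1 D1f1.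
    apply: D2E; split=> //; apply: (Phi_upclosed P2 D2f2); first exact: gamblesD.
    by move=> w /=; rewrite lerDr.
  have [[_ f2_ge0 _]|[g2 [Dg2 Lg2] gf2]] := extract_at_le P2 s2 D2f2.
    apply: D1E; split=> //; apply: (Phi_upclosed P1 D1f1); first exact: gamblesD.
    by move=> w /=; rewrite lerDl.
  have E1 := D1E _ (block_sup_mem z P1 Dg1).
  have E2 := D2E _ (block_sup_mem z P2 Dg2).
  apply: (Phi_upclosed PE (PhiD PE E1 E2)); first exact: gamblesD.
  by apply: (block_supD_le xyz Lg1 Lg2 Lk) => w /=; apply: lerD.
apply/seteqP; split.
  apply: extract_min => // f [Cf Lf].
  have [Sf|S0] := comb_sumset P1 P2 Cf; first exact: sumE.
  (* Inconsistent case: zero is a gamble at [z], so it reaches [E], which is then all gambles. *)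
  have E0 := sumE _ S0 (gambles_at_cst z 0).
  by rewrite (Phi_null PE E0); case: Lf.
apply: comb_min; first exact: Phi_extract.
- by apply: extract_mono => //; apply: sub_combl.
- by apply: extract_mono => //; apply: sub_combr.
Qed.

Lemma PsiP D x : Psi P R (D, x) <-> Phi D /\ is_support P x D.
Proof.
split=> [[x' _ [D' [PD sD] [<- <-]]]|[PD sD]]; first by split.
by exists x => //; exists D.
Qed.

End ExtractionOperators.

(** * The labeled information algebra *)

Theorem mainTheorem6 (R : realType) (Omega Q : Type)
    (P : Q -> set (set Omega)) (vee : Q -> Q -> Q)
    (P_partition : forall x, is_partition (P x))
    (P_inj : injective P)
    (P_join : forall x y, P (vee x y) = partition_join (P x) (P y)) :
  (* well-definedness: the operations stay in Psi; units and nulls are in Psi *)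
  ((forall p q, Psi P R p -> Psi P R q -> Psi P R (lcomb vee p q)) /\
   (forall p y, Psi P R p -> Psi P R (transport P y p)) /\
   (forall x, Psi P R (pos_gambles Omega R, x)) /\
   (forall x, Psi P R (gambles Omega R, x))) /\
  (* 1. semigroup *)
  ((forall p q r, Psi P R p -> Psi P R q -> Psi P R r ->
      lcomb vee p (lcomb vee q r) = lcomb vee (lcomb vee p q) r) /\
   (forall p q, Psi P R p -> Psi P R q -> lcomb vee p q = lcomb vee q p)) /\
  (* 2. quasi-separoid *)
  (join_semilattice (qle P) vee /\ quasi_separoid (qle P) vee (qindep P)) /\
  (* 3. labeling *)
  ((forall D1 x D2 y, Psi P R (D1, x) -> Psi P R (D2, y) ->
      label (lcomb vee (D1, x) (D2, y)) = vee x y) /\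
   (forall D x y, Psi P R (D, x) -> label (transport P y (D, x)) = y)) /\
  (* 4. unit and null *)
  ((forall x y, lcomb vee (pos_gambles Omega R, x) (pos_gambles Omega R, y)
      = (pos_gambles Omega R, vee x y)) /\
   (forall D x, Psi P R (D, x) ->
      lcomb vee (D, x) (pos_gambles Omega R, x) = (D, x)) /\
   (forall D x, Psi P R (D, x) ->
      lcomb vee (D, x) (gambles Omega R, x) = (gambles Omega R, x)) /\
   (forall D x y, Psi P R (D, x) ->
      transport P y (D, x) = (gambles Omega R, y)
      <-> (D, x) = (gambles Omega R, x)) /\
   (forall D x y, Psi P R (D, y) ->
      lcomb vee (D, y) (pos_gambles Omega R, x)
      = transport P (vee x y) (D, y))) /\
  (* 5. transport *)
  (forall D x y z, Psi P R (D, x) -> qindep P x y z ->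
     transport P y (D, x) = transport P y (transport P z (D, x))) /\
  (* 6. combination *)
  (forall D1 x D2 y z, Psi P R (D1, x) -> Psi P R (D2, y) -> qindep P x y z ->
     transport P z (lcomb vee (D1, x) (D2, y))
     = lcomb vee (transport P z (D1, x)) (transport P z (D2, y))) /\
  (* 7. identity *)
  (forall D x, Psi P R (D, x) -> transport P x (D, x) = (D, x)) /\
  (* 8. idempotency *)
  (forall D x y, Psi P R (D, x) -> qle P y x ->
     lcomb vee (transport P y (D, x)) (D, x) = (D, x)).
Proof.
have P_le_veel x y : qle P x (vee x y).
  by rewrite /qle P_join; apply: partition_le_joinl.
have P_le_veer x y : qle P y (vee x y).
  by rewrite /qle P_join; apply: partition_le_joinr.
have P_vee_le x y z : qle P x z -> qle P y z -> qle P (vee x y) z.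
  by rewrite /qle P_join; apply: partition_join_le.
(* Injectivity of the indexing turns equality of partitions into equality of labels; the semilattice
   identities for [vee] then follow from its least upper bound property. *)
have P_anti x y : qle P x y -> qle P y x -> x = y.
  by move=> xy yx; apply: P_inj; apply: partition_le_anti.
have veexx x : vee x x = x.
  by apply: P_anti => //; apply: P_vee_le; apply: partition_le_refl.
have veeC x y : vee x y = vee y x by apply: P_anti; apply: P_vee_le.
have P_trans x y z : qle P x y -> qle P y z -> qle P x z.
  exact: partition_le_trans.
have veeA x y z : vee x (vee y z) = vee (vee x y) z.
  have [xl xr] := (P_le_veel x y, P_le_veel (vee x y) z).
  have [yl zl] := (P_le_veer x y, P_le_veer (vee x y) z).
  have [yr zr] := (P_le_veel y z, P_le_veer y z).
  have [xr' yzr] := (P_le_veel x (vee y z), P_le_veer x (vee y z)).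
  apply: P_anti; apply: (P_vee_le) => //.
  - exact: (P_trans _ _ _ xl xr).
  - by apply: P_vee_le => //; exact: (P_trans _ _ _ yl xr).
  - by apply: P_vee_le => //; exact: (P_trans _ _ _ yr yzr).
  - exact: (P_trans _ _ _ zr yzr).
have Ppos := @Phi_pos_gambles R Omega; have Pgam := @Phi_gambles R Omega.
split; [|split; [|split; [|split; [|split; [|split; [|split; [|split]]]]]]].
- split; [|split; [|split]].
  + move=> [D1 x] [D2 y] /PsiP[P1 s1] /PsiP[P2 s2]; apply/PsiP.
    split; first exact: Phi_comb.
    by apply: support_comb => //; [apply: support_le s1 | apply: support_le s2].
  + move=> [D x] y /PsiP[PD _]; apply/PsiP.
    by split; [apply: Phi_extract | apply: extract_id].
  + by move=> x; apply/PsiP; split; last exact: extract_pos.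
  + by move=> x; apply/PsiP; split; last exact: extract_gambles.
- split.
  + move=> [D1 x] [D2 y] [D3 z] /PsiP[P1 _] /PsiP[P2 _] /PsiP[P3 _].
    by rewrite /lcomb /= combA // veeA.
  + by move=> [D1 x] [D2 y] _ _; rewrite /lcomb /= combC veeC.
- split.
    split=> // [x|x y]; first exact: partition_le_refl.
    by split=> // z; apply: P_vee_le.
  split=> [x y|x y z|x y z w|x y z].
  + exact: cond_indep_id.
  + exact: cond_indep_sym.
  + exact: cond_indep_le.
  + by rewrite /qindep P_join; apply: cond_indep_join.
- by [].
- split; [|split; [|split; [|split]]].
  + by move=> x y; rewrite /lcomb /= comb_subr.
  + move=> D x /PsiP[PD _]; rewrite /lcomb /= combC comb_subr //.
      by rewrite veexx.
    exact: pos_sub_Phi.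
  + move=> D x /PsiP[PD _]; rewrite /lcomb /= comb_subr //.
      by rewrite veexx.
    exact: Phi_sub_gambles.
  + move=> D x y /PsiP[PD _]; split=> [[eG]|[->]].
      by rewrite (extract_eq_gambles PD eG).
    by rewrite /transport /= extract_gambles.
  (* Both sides equal [D] with label [vee x y]: the unit is absorbed on the left, and on the right
     the support [y] passes to the finer [vee x y]. *)
  + move=> D x y /PsiP[PD sD]; rewrite /lcomb /transport /= veeC.
    rewrite combC comb_subr //; last exact: pos_sub_Phi.
    by rewrite (support_le PD (P_le_veer x y) sD).
- move=> D x y z /PsiP[PD sD] xyz.
  by rewrite /transport /= -(extract_extract_indep P_partition PD sD xyz).
- move=> D1 x D2 y z /PsiP[P1 s1] /PsiP[P2 s2] xyz.
  rewrite /lcomb /transport /= (extract_comb_indep P_partition P1 P2 s1 s2 xyz).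
  by rewrite veexx.
- by move=> D x /PsiP[_ sD]; rewrite /transport /= sD.
(* The extraction is contained in [D], so combining absorbs it, and [vee y x] is [x]. *)
- move=> D x y /PsiP[PD _] yx; rewrite /lcomb /transport /= comb_subr //.
    rewrite (P_anti (vee y x) x) //; apply: P_vee_le => //.
    exact: partition_le_refl.
  exact: extract_sub.
Qed.
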